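(* Let $n\ge1$ and let $\chi\colon\mu_{q+1}\to\overline{\mathbb{Q}}_\ell^\times$ be a character. Then there is a decomposition $$\omega_{\mathrm{U}_{n+1}}[\chi]\big|_{\mathrm{U}_n(\mathbb{F}_q)}=\bigoplus_{\chi'\in\mu_{q+1}^\vee\setminus\{\chi\}}\omega_{\mathrm{U}_n}[\chi']$$ as $\mathrm{U}_n(\mathbb{F}_q)$-representations, where $\mathrm{U}_n(\mathbb{F}_q)$ is regarded as a subgroup of $\mathrm{U}_{n+1}(\mathbb{F}_q)$ via $g\mapsto\mathrm{diag}(g,1)$.
   Context: Let $p$ be a prime, $q$ a power of $p$, $\ell\ne p$ a prime. Put $\mu_{q+1}=\{\zeta\in\mathbb{F}_{q^2}\mid\zeta^{q+1}=1\}$ and $\mu_{q+1}^\vee=\operatorname{Hom}(\mu_{q+1},\overline{\mathbb{Q}}_\ell^\times)$. For $m\ge1$, let $h_m((v_k),(v'_k))=\sum_{k=1}^m v_k^qv'_k$ on $\mathbb{F}_{q^2}^m$ and let $\mathrm{U}_m(\mathbb{F}_q)=\mathrm{U}(h_m)$ be its isometry group; $\mu_{q+1}$ is identified with the subgroup of scalar matrices in $\mathrm{U}_m(\mathbb{F}_q)$ (the center). Put $\mathbb{F}_{q,+}=\{a\in\mathbb{F}_{q^2}\mid a+a^q=0\}$ and let $\mathrm{H}(h_m)=\{(v,a)\in\mathbb{F}_{q^2}^m\times\mathbb{F}_{q^2}\mid a+a^q=h_m(v,v)\}$ with multiplication $(v,a)(v',a')=(v+v',a+a'+h_m(v,v'))$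 and center $\{0\}\times\mathbb{F}_{q,+}$; $\mathrm{U}(h_m)$ acts on it by $(v,a)\mapsto(gv,a)$, and $\mathrm{HU}(h_m)=\mathrm{H}(h_m)\rtimes\mathrm{U}(h_m)$. For a non-trivial character $\psi$ of $\mathbb{F}_{q,+}$, the Heisenberg--Weil representation $\rho_{\mathrm{HU}(h_m),\psi}$ is the unique irreducible $\overline{\mathbb{Q}}_\ell$-representation of $\mathrm{HU}(h_m)$ whose restriction to $\mathrm{H}(h_m)$ is the unique irreducible representation of $\mathrm{H}(h_m)$ containing the central character $\psi$, and with $\operatorname{Tr}\rho_{\mathrm{HU}(h_m),\psi}(g)=(-1)^m(-q)^{\dim_{\mathbb{F}_{q^2}}\operatorname{Ker}(g-1)}$ for $g\in\mathrm{U}(h_m)$. The Weil representation is $\omega_{\mathrm{U}_m}=\rho_{\mathrm{HU}(h_m),\psi}|_{\mathrm{U}(h_m)}$ (independent of $\psi$). For $\chi\in\mu_{q+1}^\vee$, $\omega_{\mathrm{U}_m}[\chi]$ denotes the $\chi$-isotypic part under the scalars $\mu_{q+1}$, viewed as an $\mathrm{U}_m(\mathbb{F}_q)$-representation (possibly zero). *)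

(* Defs.v *)
From HB Require Import structures.
From mathcomp Require Import all_boot all_order all_fingroup all_algebra.
From mathcomp Require Import all_solvable all_field all_character.
From mathcomp Require Import ring.

Set Implicit Arguments.
Unset Strict Implicit.
Unset Printing Implicit Defensive.

Import GRing.Theory.
Local Open Scope ring_scope.

(* Throughout, [F] stands for F_{q^2}, so that [x ^+ q] is the conjugation of
   F_{q^2} over F_q, and [K] is the coefficient field of representations: any
   algebraically closed field, assumed of characteristic 0 where it matters
   (e.g. an algebraic closure of Q_l). *)

Section MuDual.

Variables (F : finFieldType) (q : nat).

Record mu : Type := Mu {mu_val : F; _ : mu_val ^+ q.+1 == 1}.

HB.instance Definition _ := [isSub for mu_val].
HB.instance Definition _ := [Finite of mu by <:].

Lemma muP (x : mu) : mu_val x ^+ q.+1 = 1.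
Proof. exact/eqP/(valP x). Qed.

Fact mu_mul_subproof (x y : mu) : (mu_val x * mu_val y) ^+ q.+1 == 1.
Proof. by rewrite exprMn (muP x) (muP y) mulr1. Qed.
Fact mu_one_subproof : (1 : F) ^+ q.+1 == 1.
Proof. by rewrite expr1n. Qed.
Fact mu_inv_subproof (x : mu) : (mu_val x)^-1 ^+ q.+1 == 1.
Proof. by rewrite exprVn (muP x) invr1. Qed.

Definition mu_mul (x y : mu) : mu := Mu (mu_mul_subproof x y).
Definition mu_one : mu := Mu mu_one_subproof.
Definition mu_inv (x : mu) : mu := Mu (mu_inv_subproof x).

Fact mu_mulA : associative mu_mul.
Proof. by move=> x y z; apply: val_inj; rewrite /= mulrA. Qed.
Fact mu_mul1 : left_id mu_one mu_mul.
Proof. by move=> x; apply: val_inj; rewrite /= mul1r. Qed.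
Fact mu_mulV : left_inverse mu_one mu_inv mu_mul.
Proof.
move=> x; apply: val_inj; rewrite /= mulVf //.
by apply/eqP=> x0; have /eqP := muP x; rewrite x0 expr0n eq_sym oner_eq0.
Qed.

HB.instance Definition _ :=
  Finite_isGroup.Build mu mu_mulA mu_mul1 mu_mulV.

Variable K : closedFieldType.

(* Characters mu_{q+1} -> K^*; the values are automatically non-zero. *)
Definition is_char (chi : {ffun mu -> K}) : bool :=
  (chi 1%g == 1) && [forall x, forall y, chi (x * y)%g == chi x * chi y].

Record mu_dual : Type := MuDual {mu_dual_val : {ffun mu -> K}; _ : is_char mu_dual_val}.

HB.instance Definition _ := [isSub for mu_dual_val].
HB.instance Definition _ := [Choice of mu_dual by <:].

Definition mu_dual_fun (chi : mu_dual) : mu -> K := mu_dual_val chi.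
Coercion mu_dual_fun : mu_dual >-> Funclass.

(* [mu_dual] is finite, since characters take values in the (q+1)-st roots
   of unity of K. *)
Definition unity_roots : seq K := sval (closed_field_poly_normal ('X^(q.+1) - 1)).

Fact mu_dualX (chi : mu_dual) x : chi x \in unity_roots.
Proof.
case/andP: (valP chi) => /eqP chi_1 /forallP chiM.
have chi1: chi 1%g = 1 by [].
have {}chiM y z : chi (y * z)%g = chi y * chi z by have /forallP/(_ z)/eqP := chiM y.
have chiX k : chi (x ^+ k)%g = chi x ^+ k.
  by elim: k => [|k IHk]; rewrite ?expg0 ?expr0 ?chi1 // expgS exprS chiM IHk.
have xX : (x ^+ q.+1)%g = 1%g.
  have vX k : mu_val (x ^+ k)%g = mu_val x ^+ k.
    by elim: k => [|k IHk]; rewrite ?expg0 ?expr0 // expgS exprS /= IHk.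
  by apply: val_inj; rewrite /= vX muP.
rewrite /unity_roots; case: closed_field_poly_normal => r /= def_r.
have: root ('X^(q.+1) - 1 : {poly K}) (chi x).
  by rewrite rootE !hornerE -chiX xX chi1 subrr.
rewrite def_r rootZ ?root_prod_XsubC //.
by rewrite lead_coef_eq0 -size_poly_eq0 size_XnsubC.
Qed.

Definition mu_dual_code (chi : mu_dual) : {ffun mu -> 'I_(size unity_roots).+1} :=
  [ffun x => inord (index (chi x) unity_roots)].
Definition mu_dual_decode (f : {ffun mu -> 'I_(size unity_roots).+1}) :
  option mu_dual := insub [ffun x => unity_roots`_(f x)].

Fact mu_dual_codeK : pcancel mu_dual_code mu_dual_decode.
Proof.
move=> chi; rewrite /mu_dual_decode.
suff ->: [ffun x => unity_roots`_(mu_dual_code chi x)] = mu_dual_val chi by rewrite valK.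
apply/ffunP=> x; rewrite !ffunE inordK ?nth_index ?mu_dualX //.
by rewrite ltnS index_size.
Qed.

HB.instance Definition _ : isCountable mu_dual := PCanIsCountable mu_dual_codeK.
HB.instance Definition _ : isFinite mu_dual := PCanIsFinite mu_dual_codeK.

End MuDual.

Section Unitary.

Variables (F : finFieldType) (q : nat).

Definition herm m (v w : 'cV[F]_m) : F := \sum_(k < m) v k 0 ^+ q * w k 0.

Definition is_isometry m (g : 'M[F]_m) : bool :=
  (g \in unitmx) &&
  [forall v : 'cV[F]_m, forall w : 'cV[F]_m, herm (g *m v) (g *m w) == herm v w].

Record Um (m : nat) : Type := MkUm {Um_val : 'M[F]_m; _ : is_isometry Um_val}.

HB.instance Definition _ m := [isSub for @Um_val m].
HB.instance Definition _ m := [Finite of Um m by <:].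

Lemma isometryP m (g : 'M[F]_m) :
  reflect (g \in unitmx /\ forall v w, herm (g *m v) (g *m w) = herm v w)
          (is_isometry g).
Proof.
apply: (iffP andP) => -[gU gh]; split=> //.
  by move=> v w; have /forallP/(_ w)/eqP := forallP gh v.
by apply/forallP=> v; apply/forallP=> w; apply/eqP.
Qed.

Lemma Um_unit m (g : Um m) : Um_val g \in unitmx.
Proof. by case/isometryP: (valP g). Qed.
Lemma Um_herm m (g : Um m) v w : herm (Um_val g *m v) (Um_val g *m w) = herm v w.
Proof. by case/isometryP: (valP g). Qed.

Fact Um_mul_subproof m (g h : Um m) : is_isometry (Um_val g *m Um_val h).
Proof.
apply/isometryP; split=> [|v w]; first by rewrite unitmx_mul !Um_unit.
by rewrite -!mulmxA !Um_herm.
Qed.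
Fact Um_one_subproof m : is_isometry (1%:M : 'M[F]_m).
Proof. by apply/isometryP; split=> [|v w]; rewrite ?unitmx1 // !mul1mx. Qed.
Fact Um_inv_subproof m (g : Um m) : is_isometry (invmx (Um_val g)).
Proof.
apply/isometryP; split=> [|v w]; first by rewrite unitmx_inv Um_unit.
by rewrite -(Um_herm g) !mulKVmx ?Um_unit.
Qed.

Definition Um_mul m (g h : Um m) : Um m := MkUm (Um_mul_subproof g h).
Definition Um_one m : Um m := MkUm (Um_one_subproof m).
Definition Um_inv m (g : Um m) : Um m := MkUm (Um_inv_subproof g).

Fact Um_mulA m : associative (@Um_mul m).
Proof. by move=> x y z; apply: val_inj; rewrite /= mulmxA. Qed.
Fact Um_mul1 m : left_id (@Um_one m) (@Um_mul m).
Proof. by move=> x; apply: val_inj; rewrite /= mul1mx. Qed.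
Fact Um_mulV m : left_inverse (@Um_one m) (@Um_inv m) (@Um_mul m).
Proof. by move=> x; apply: val_inj; rewrite /= mulVmx ?Um_unit. Qed.

HB.instance Definition _ m :=
  Finite_isGroup.Build (Um m) (@Um_mulA m) (@Um_mul1 m) (@Um_mulV m).

Fact Um_scal_subproof m (z : mu F q) : is_isometry ((mu_val z)%:M : 'M[F]_m).
Proof.
have zX := muP z; apply/isometryP; split=> [|v w].
  rewrite unitmxE det_scalar unitfE expf_neq0 //.
  by apply/eqP=> z0; move: zX; rewrite z0 expr0n /= => /eqP; rewrite eq_sym oner_eq0.
apply: eq_bigr => k _; rewrite !mul_scalar_mx !mxE exprMn mulrACA.
by rewrite -exprSr zX mul1r.
Qed.
Definition Um_scal m (z : mu F q) : Um m := MkUm (Um_scal_subproof m z).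

Fact Um_emb_subproof n (g : Um n) :
  is_isometry (block_mx (Um_val g) 0 0 1%:M : 'M[F]_(n + 1)).
Proof.
apply/isometryP; split=> [|v w].
  by rewrite unitmxE det_ublock det1 mulr1 -unitmxE Um_unit.
have hermD (x y : 'cV[F]_(n + 1)) :
    herm x y = herm (usubmx x) (usubmx y) + herm (dsubmx x) (dsubmx y).
  by rewrite /herm big_split_ord /=; congr (_ + _); apply: eq_bigr => k _;
     rewrite !mxE.
rewrite !hermD -(vsubmxK v) -(vsubmxK w) !mul_block_col !col_mxKu !col_mxKd.
by rewrite !mul0mx !mul1mx !addr0 !add0r Um_herm.
Qed.
Definition Um_emb n (g : Um n) : Um (n + 1) := MkUm (Um_emb_subproof g).

Fact Um_embM n : {in [set: Um n] &, {morph @Um_emb n : g h / (g * h)%g}}.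
Proof.
move=> g h _ _; apply: val_inj => /=.
by rewrite mulmx_block !mulmx0 !mul0mx !addr0 !add0r mulmx1.
Qed.
Canonical Um_emb_morphism n := Morphism (@Um_embM n).

End Unitary.

Section HeisenbergUnitary.

Variables (F : finFieldType) (q : nat).
Hypothesis cardF : #|F| = (q ^ 2)%N.

Fact conjqK (x : F) : (x ^+ q) ^+ q = x.
Proof. by rewrite -exprM -[(q * q)%N]/(q ^ 2)%N -cardF expf_card. Qed.

Fact conjqD : {morph (fun x : F => x ^+ q) : x y / x + y}.
Proof.
move=> x y; have [p p_pr charF] := finPcharP F.
apply: exprDn_pchar.
have pF : p.-nat #|F|.
  have := abelem_pgroup (fin_ring_pchar_abelem charF).
  by rewrite /pgroup cardsT.
have: (p.-nat q)%N.
  by move: pF; rewrite cardF pnatX orbF.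
by rewrite (eq_pnat _ (pcharf_eq charF)).
Qed.

Fact conjq0 : (0 : F) ^+ q = 0.
Proof. by apply: (addIr (0 ^+ q)); rewrite -conjqD !add0r. Qed.

Fact conjqN (x : F) : (- x) ^+ q = - (x ^+ q).
Proof. by apply/eqP; rewrite -addr_eq0 -conjqD addNr conjq0. Qed.

Lemma hermDl m (u v w : 'cV[F]_m) : herm q (u + v) w = herm q u w + herm q v w.
Proof. by rewrite -big_split; apply: eq_bigr => k _; rewrite mxE conjqD mulrDl. Qed.
Lemma hermDr m (u v w : 'cV[F]_m) : herm q w (u + v) = herm q w u + herm q w v.
Proof. by rewrite -big_split; apply: eq_bigr => k _; rewrite mxE mulrDr. Qed.
Lemma hermNl m (v w : 'cV[F]_m) : herm q (- v) w = - herm q v w.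
Proof. by rewrite -sumrN; apply: eq_bigr => k _; rewrite mxE conjqN mulNr. Qed.
Lemma hermNr m (v w : 'cV[F]_m) : herm q w (- v) = - herm q w v.
Proof. by rewrite -sumrN; apply: eq_bigr => k _; rewrite mxE mulrN. Qed.
Lemma herm0l m (v : 'cV[F]_m) : herm q 0 v = 0.
Proof. by apply: (addIr (herm q 0 v)); rewrite -hermDl !add0r. Qed.
Lemma hermC m (v w : 'cV[F]_m) : herm q v w ^+ q = herm q w v.
Proof.
rewrite /herm (big_morph _ conjqD conjq0).
by apply: eq_bigr => k _; rewrite exprMn conjqK mulrC.
Qed.

(* [cardF] is a parameter of the Heisenberg group because the group law is only
   well defined when [x ^+ q] is an involutive automorphism of F. *)
Record Heis (cF : #|F| = (q ^ 2)%N) (m : nat) : Type := MkHeis {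
  Heis_val : 'cV[F]_m * F;
  _ : Heis_val.2 + Heis_val.2 ^+ q == herm q Heis_val.1 Heis_val.1
}.

Local Notation H := (Heis cardF).

HB.instance Definition _ m := [isSub for @Heis_val cardF m].
HB.instance Definition _ m := [Finite of H m by <:].

Lemma HeisP m (x : H m) :
  (Heis_val x).2 + (Heis_val x).2 ^+ q = herm q (Heis_val x).1 (Heis_val x).1.
Proof. exact/eqP/(valP x). Qed.

Fact Heis_mul_subproof m (x y : H m)
    (z := ((Heis_val x).1 + (Heis_val y).1, (Heis_val x).2 + (Heis_val y).2 + herm q (Heis_val x).1 (Heis_val y).1)) :
  z.2 + z.2 ^+ q == herm q z.1 z.1.
Proof.
by apply/eqP; rewrite /= !conjqD hermC hermDl !hermDr -!HeisP; ring.
Qed.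

Fact Heis_one_subproof m (z : 'cV[F]_m * F := (0, 0)) :
  z.2 + z.2 ^+ q == herm q z.1 z.1.
Proof. by rewrite /= herm0l conjq0 addr0. Qed.

Fact Heis_inv_subproof m (x : H m)
    (z := (- (Heis_val x).1, (Heis_val x).2 ^+ q)) :
  z.2 + z.2 ^+ q == herm q z.1 z.1.
Proof. by rewrite /= conjqK addrC HeisP hermNl hermNr opprK. Qed.

Definition Heis_mul m (x y : H m) : H m := MkHeis cardF (Heis_mul_subproof x y).
Definition Heis_one m : H m := MkHeis cardF (Heis_one_subproof m).
Definition Heis_inv m (x : H m) : H m := MkHeis cardF (Heis_inv_subproof x).

Fact Heis_mulA m : associative (@Heis_mul m).
Proof.
move=> x y z; apply: val_inj; rewrite /= hermDl hermDr addrA.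
by congr pair; ring.
Qed.
Fact Heis_mul1 m : left_id (@Heis_one m) (@Heis_mul m).
Proof.
by move=> x; apply: val_inj; rewrite /= herm0l !add0r addr0 -surjective_pairing.
Qed.
Fact Heis_mulV m : left_inverse (@Heis_one m) (@Heis_inv m) (@Heis_mul m).
Proof.
move=> x; apply: val_inj; rewrite /= hermNl -HeisP addNr.
by congr pair; ring.
Qed.

HB.instance Definition _ m :=
  Finite_isGroup.Build (H m) (@Heis_mulA m) (@Heis_mul1 m) (@Heis_mulV m).

(* MathComp actions are right actions, so [g] acts by the left action
   (v, a) |-> (gv, a) of [g^-1]; see [sdpair_left_act] below. *)
Fact Heis_act_subproof m (x : H m) (g : Um F q m)
    (z := (Um_val g^-1%g *m (Heis_val x).1, (Heis_val x).2)) :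
  z.2 + z.2 ^+ q == herm q z.1 z.1.
Proof. by rewrite /z (Um_herm g^-1%g) HeisP. Qed.

Definition Heis_act m (x : H m) (g : Um F q m) : H m :=
  MkHeis cardF (Heis_act_subproof x g).

Fact Heis_act_is_action m : is_action [set: Um F q m] (@Heis_act m).
Proof.
split=> [g x y|x g h _ _].
  move=> /(congr1 val)[/(congr1 (mulmx (Um_val g)))]; rewrite !(mulKVmx (Um_unit g)) => e1 e2.
  by apply: val_inj; apply: injective_projections.
by apply: val_inj; congr pair; rewrite invMg mulmxA.
Qed.

Canonical Heis_action m := Action (@Heis_act_is_action m).

Fact Heis_act_is_groupAction m : is_groupAction [set: H m] (Heis_action m).
Proof.
move=> g _; rewrite inE; apply/andP; split; first by apply/subsetP=> x; rewrite inE.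
apply/morphicP=> x y _ _; rewrite !permE /=; apply: val_inj => /=.
by rewrite mulmxDr (Um_herm g^-1%g).
Qed.

Canonical Heis_groupAction m := GroupAction (@Heis_act_is_groupAction m).

Definition HU (m : nat) := sdprod_by (Heis_groupAction m).

Lemma sdpair_left_act m (x : H m) (g : Um F q m) :
  (sdpair2 (Heis_groupAction m) g * sdpair1 (Heis_groupAction m) x *
    (sdpair2 (Heis_groupAction m) g)^-1)%g =
  sdpair1 (Heis_groupAction m) (Heis_act x g^-1%g).
Proof.
rewrite sdpair_act ?inE //.
by rewrite morphV ?inE // conjgE invgK mulgA.
Qed.

Lemma Heis_actE m (x : H m) (g : Um F q m) :
  Heis_val (Heis_act x g^-1%g) = (Um_val g *m (Heis_val x).1, (Heis_val x).2).
Proof. by congr pair; rewrite invgK. Qed.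

End HeisenbergUnitary.

Section Pullback.

Variables (K : fieldType) (gT rT : finGroupType) (f : {morphism [set: gT] >-> rT}).

Fact pullback_mx_repr d (rG : mx_representation K [set: rT] d) :
  mx_repr [set: gT] (fun x => rG (f x)).
Proof.
split=> [|x y _ _]; first by rewrite morph1 repr_mx1.
by rewrite morphM ?inE // repr_mxM ?inE.
Qed.
Definition pullback_repr d (rG : mx_representation K [set: rT] d) :=
  MxRepresentation (pullback_mx_repr rG).

End Pullback.

Section HeisenbergWeil.

Variables (K : closedFieldType) (F : finFieldType) (q : nat).
Hypothesis cardF : #|F| = (q ^ 2)%N.

Definition Fplus : {pred F} := [pred a : F | a + a ^+ q == 0].

(* Characters of F_{q,+} are represented by functions on F, whose values outside
   of F_{q,+} are irrelevant. *)
Definition nontrivial_add_char (psi : F -> K) : Prop :=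
  [/\ psi 0 = 1,
      {in Fplus &, forall a b, psi (a + b) = psi a * psi b}
    & exists2 a, a \in Fplus & psi a != 1].

Variables (m d : nat) (rho : mx_representation K [set: HU cardF m] d).

Definition res_Heis : mx_representation K [set: Heis cardF m] d :=
  pullback_repr (sdpair1_morphism (Heis_groupAction cardF m)) rho.

Definition res_Um : mx_representation K [set: Um F q m] d :=
  pullback_repr (sdpair2_morphism (Heis_groupAction cardF m)) rho.

Definition contains_central_char (psi : F -> K) : Prop :=
  exists2 v : 'rV[K]_d, v != 0 &
    forall z : Heis cardF m, (Heis_val z).1 = 0 ->
      v *m res_Heis z = psi (Heis_val z).2 *: v.

(* These conditions determine [rho] up to isomorphism, given [psi]. *)
Record is_Heisenberg_Weil (psi : F -> K) : Prop := IsHeisenbergWeil {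
  HW_irr : mx_irreducible rho;
  HW_irr_Heis : mx_irreducible res_Heis;
  HW_central : contains_central_char psi;
  (* the columns of [cokermx A] span the space of v such that A *m v = 0 *)
  HW_trace : forall g : Um F q m,
    \tr (res_Um g) =
      (-1) ^+ m * (- q%:R) ^+ \rank (cokermx (Um_val g - 1%:M))
}.

End HeisenbergWeil.

Section Isotypic.

Variables (K : closedFieldType) (F : finFieldType) (q m d : nat).
Variable omega : mx_representation K [set: Um F q m] d.
Variable chi : mu_dual F q K.

(* [K]-representations are matrix representations acting on row vectors; the
   [chi]-isotypic subspace is the common eigenspace of the scalars. *)
Definition isotypic_mx : 'M[K]_d :=
  (\bigcap_(z : mu F q) eigenspace (omega (Um_scal m z)) (chi z))%MS.

Fact isotypic_mxmodule : mxmodule omega isotypic_mx.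
Proof.
apply/mxmoduleP=> g _; apply/sub_bigcapmxP=> z _; apply/eigenspaceP.
have comm : (g * Um_scal m z = Um_scal m z * g)%g.
  by apply: val_inj; rewrite /= scalar_mxC.
rewrite -mulmxA -repr_mxM ?inE // comm repr_mxM ?inE // mulmxA scalemxAl.
congr (_ *m _); apply/eigenspaceP; exact: bigcapmx_inf.
Qed.

Definition isotypic_part : representation K [set: Um F q m] :=
  Representation (submod_repr isotypic_mxmodule).

End Isotypic.

(* Main.v *)
Require Import Defs.
From HB Require Import structures.
From mathcomp Require Import all_boot all_order all_fingroup all_algebra.
From mathcomp Require Import all_solvable all_field all_character.

Set Implicit Arguments.
Unset Strict Implicit.
Unset Printing Implicit Defensive.

Import GRing.Theory.
Local Open Scope ring_scope.

(* Over an algebraically closed field of characteristic 0, representations of a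
   finite group are determined by their traces: the central idempotents of the
   group ring act with trace equal to their rank, so equal traces force a common
   irreducible constituent, which can be split off by Maschke's theorem.

   It remains to compare traces. Write w_m for the trace of the Weil
   representation of U_m. Since the fixed space of z.diag(g, 1) has one more
   dimension than that of zg if z = 1, and the same dimension otherwise, the
   trace formula yields
     w_(n+1)(z.diag(g, 1)) = (q + 1)[z = 1] w_n(g) - w_n(zg).
   Averaging this against chi^-1 over the q + 1 elements z of mu_(q+1) gives
     w_(n+1)[chi](diag(g, 1)) = w_n(g) - w_n[chi](g),
   and w_n is the sum of all the w_n[chi']. *)

(** Factor [A] = CR with C of full column rank and R of full row rank. Cancelling C and R in CRCR =
    CR gives RC = 1, whose trace is the rank. *)
Lemma mxtrace_idempotent (F : fieldType) n (A : 'M[F]_n) :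
  A *m A = A -> \tr A = (\rank A)%:R.
Proof.
move=> AA; rewrite -{1}(mulmx_base A) mxtrace_mulC -[RHS]mxtrace1; congr (\tr _).
apply: (row_free_inj (row_base_free A)); apply: (row_full_inj (col_base_full A)).
by rewrite mul1mx -(mulmxA (row_base A)) mulmx_base (mulmxA (col_base A)) mulmx_base.
Qed.

(** * Representations in characteristic 0 are determined by their traces *)

Section TraceDeterminesRepresentation.

Variables (K : closedFieldType) (gT : finGroupType) (G : {group gT}).
Hypothesis charK : [pchar K] =i pred0.

Let aG := regular_repr K G.
Let R_G := group_ring K G.
Let sG : irrType K G := DecSocleType aG.

Lemma pchar0'group : ([pchar K]^'.-group G)%g.
Proof. by apply/pgroupP=> p _ _; rewrite inE /= charK. Qed.
Let K'G := pchar0'group.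

Lemma Wedderburn_id_ring (i : sG) : (Wedderburn_id i \in R_G)%MS.
Proof.
rewrite /R_G -(Wedderburn_sum_pchar sG K'G).
by apply: submx_trans (Wedderburn_id_mem i) (sumsmx_sup i _ _).
Qed.

Lemma gring_op_submod n (rG : mx_representation K G n) (U : 'M_n)
    (modU : mxmodule rG U) A :
    (A \in R_G)%MS ->
  gring_op (submod_repr modU) A = in_submod U (val_submod 1%:M *m gring_op rG A).
Proof.
case/envelop_mxP=> a ->; rewrite !(linear_sum, mulmx_sumr) /=.
apply: eq_bigr => x Gx.
by rewrite !linearZ /= !gring_opG // -scalemxAr -scalemxAl.
Qed.

Lemma mxtrace_gring_op n1 n2 (rG1 : mx_representation K G n1)
    (rG2 : mx_representation K G n2) A :
    {in G, forall x, \tr (rG1 x) = \tr (rG2 x)} -> (A \in R_G)%MS ->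
  \tr (gring_op rG1 A) = \tr (gring_op rG2 A).
Proof.
move=> eq_tr /envelop_mxP[a ->]; rewrite !linear_sum /=.
by apply: eq_bigr => x Gx; rewrite !linearZ /= !gring_opG // eq_tr.
Qed.

(** The Wedderburn idempotents sum to 1, and those of the other components annihilate [rG]. *)
Lemma gring_op_irr_comp n (rG : mx_representation K G n) :
  mx_irreducible rG -> gring_op rG (Wedderburn_id (irr_comp sG rG)) = 1%:M.
Proof.
move=> irrG; rewrite -(gring_op1 rG) -(Wedderburn_sum_id_pchar sG K'G).
rewrite linear_sum (bigD1 (irr_comp sG rG)) //= big1 ?addr0 // => j ne_j.
by rewrite (irr_comp'_op0_pchar K'G irrG ne_j) ?Wedderburn_id_mem.
Qed.

Lemma mxtrace_gring_op_Wedderburn_id n (rG : mx_representation K G n) (i : sG) :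
  \tr (gring_op rG (Wedderburn_id i))
    = (\rank (gring_op rG (Wedderburn_id i)))%:R.
Proof.
apply: mxtrace_idempotent; rewrite -gring_opM ?Wedderburn_id_ring //.
have [_ Re ideR _] := Wedderburn_is_id_pchar K'G i.
by rewrite ideR.
Qed.

(** By Maschke, [rG] is a sum of simple submodules. An idempotent acting non-trivially is non-zero
    on one of them, which must then have type [i]. *)
Lemma exists_simple_irr_comp n (rG : mx_representation K G n) (i : sG) :
  gring_op rG (Wedderburn_id i) != 0 ->
  exists2 M, mxsimple rG M &
    forall modM : mxmodule rG M, irr_comp sG (submod_repr modM) = i.
Proof.
move=> nz_op.
have [I W S simW defW _]: mxsemisimple rG 1%:M.
  apply: dec_mx_reducible_semisimple (mxmodule1 rG) _.
  exact: mx_Maschke_pchar.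
have [k nzk | all0] := pickP (fun k => W k *m gring_op rG (Wedderburn_id i) != 0).
  exists (W k) => // modM; apply: contraNeq nzk; rewrite eq_sym => ne_i.
  have irrM : mx_irreducible (submod_repr modM) by apply/submod_mx_irr.
  have := irr_comp'_op0_pchar K'G irrM ne_i (Wedderburn_id_mem i).
  rewrite gring_op_submod ?Wedderburn_id_ring // => /eqP.
  rewrite -val_submod_eq0 in_submodK.
    by rewrite -!mxrank_eq0 (eqmxMr _ (val_submod1 (W k))).
  exact: (mxmodule_envelop modM (gring_mxP rG _) (val_submodP _)).
case/eqP: nz_op; apply/eqP; rewrite -[gring_op _ _]mul1mx -submx0.
rewrite -(eqmxMr _ defW) sumsmxMr; apply/sumsmx_subP=> k _.
by move/negbFE/eqP: (all0 k) => ->.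
Qed.

Lemma mx_rsim_mxtrace n1 n2 (rG1 : mx_representation K G n1)
    (rG2 : mx_representation K G n2) :
  {in G, forall x, \tr (rG1 x) = \tr (rG2 x)} -> mx_rsim rG1 rG2.
Proof.
(* Characteristic 0 enters here: degrees (traces at 1) and ranks of idempotents can be read off from
   their images in [K]. *)
have natK m1 m2 : m1%:R = m2%:R :> K -> m1 = m2.
  wlog le12: m1 m2 / (m1 <= m2)%N.
    by move=> IH; case: (leqP m1 m2) => [|/ltnW] /IH // IH' /esym/IH'.
  move/esym/eqP; rewrite -subr_eq0 -natrB // ((pcharf0P K).1 charK).
  by rewrite subn_eq0 => le21; apply/eqP; rewrite eqn_leq le12.
have [m] := ubnP n1; elim: m => // m IHm in n1 n2 rG1 rG2 *.
rewrite ltnS => le_n1 eq_tr.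
have eq_n: n1 = n2.
  by apply: natK; have:= eq_tr _ (group1 G); rewrite !repr_mx1 !mxtrace1.
case: _ / eq_n rG2 eq_tr => rG2 eq_tr.
have [n0 | n_gt0] := posnP n1.
  exists 1%:M => // [|x Gx]; first by rewrite row_free_unit unitmx1.
  by apply/matrixP=> k; have := ltn_ord k; rewrite {2}n0.
have [M1 simM1 _]: {M | mxsimple rG1 M & M <= 1%:M}%MS.
  by apply: dec_mxsimple_exists; rewrite ?mxmodule1 // -mxrank_eq0 mxrank1 -lt0n.
have [modM1 nzM1 _] := simM1.
have irrM1 : mx_irreducible (submod_repr modM1) by apply/submod_mx_irr.
pose i := irr_comp sG (submod_repr modM1).
have [|M2 simM2 irrM2i] := @exists_simple_irr_comp _ rG2 i.
  rewrite -mxrank_eq0.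
  have <- : \rank (gring_op rG1 (Wedderburn_id i))
          = \rank (gring_op rG2 (Wedderburn_id i)).
    apply: natK; rewrite -!mxtrace_gring_op_Wedderburn_id.
    by apply: mxtrace_gring_op; rewrite ?Wedderburn_id_ring.
  (* The idempotent of type [i] is the identity on [M1], so it cannot vanish on [rG1]. *)
  rewrite mxrank_eq0; apply: contraNneq nzM1 => op0.
  have:= gring_op_irr_comp irrM1; rewrite gring_op_submod ?Wedderburn_id_ring //.
  rewrite op0 mulmx0 linear0 => /esym/eqP.
  by rewrite -[1%:M == 0]mxrank_eq0 mxrank1 mxrank_eq0.
have [modM2 _ _] := simM2.
have irrM2 : mx_irreducible (submod_repr modM2) by apply/submod_mx_irr.
have simM12 : mx_rsim (submod_repr modM1) (submod_repr modM2).
  apply: mx_rsim_trans (rsim_irr_comp_pchar sG K'G irrM1) _.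
  by rewrite -/i -(irrM2i modM2); apply/mx_rsim_sym/rsim_irr_comp_pchar.
have [W1 modW1 def1 dx1] := mx_Maschke_pchar rG1 K'G modM1 (submx1 M1).
have [W2 modW2 def2 dx2] := mx_Maschke_pchar rG2 K'G modM2 (submx1 M2).
have simW12 : mx_rsim (submod_repr modW1) (submod_repr modW2).
  apply: IHm => [|x Gx].
    apply: leq_trans le_n1.
    rewrite -[X in (_ <= X)%N](mxrank1 K) -def1 (mxdirectP dx1) /= -add1n leq_add2r.
    by rewrite lt0n mxrank_eq0.
  (* The trace on a complement is the total trace minus that on the simple part, and these agree on
     both sides. *)
  apply: (addrI (\tr (submod_repr modM1 x))).
  rewrite (mxtrace_dadd_mod modM1 modW1 (mxmodule1 rG1)) //.
  rewrite (mxtrace_rsim simM12) // (mxtrace_dadd_mod modM2 modW2 (mxmodule1 rG2)) //.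
  by rewrite !mxtrace_submod1 // eq_tr.
apply: mx_rsim_trans (mx_rsim_sym (rsim_submod1 (mxmodule1 rG1) _)) _ => //.
apply: mx_rsim_trans _ (rsim_submod1 (mxmodule1 rG2) _) => //.
pose rM2 := Representation (submod_repr modM2).
pose rW2 := Representation (submod_repr modW2).
apply: (@mx_rsim_trans _ _ _ _ _ _ _ (dadd_grepr rM2 rW2)).
  exact: (@mx_rsim_dadd _ _ _ _ rG1 _ _ _ rM2 rW2 modM1 modW1 _ def1 dx1 simM12 simW12).
apply: mx_rsim_sym; apply: mx_rsim_dadd def2 dx2 _ _; exact: mx_rsim_refl.
Qed.

End TraceDeterminesRepresentation.

(** * Primitive roots of unity and orthogonality for the characters of mu_(q+1) *)

Lemma closed_field_prim_root (K : closedFieldType) n :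
  n%:R != 0 :> K -> {z : K | n.-primitive_root z}.
Proof.
move=> nz_n; have n_gt0: (0 < n)%N by case: n nz_n => //; rewrite eqxx.
have [r def_r] := closed_field_poly_normal ('X^n - 1 : {poly K}).
rewrite (monicP _) ?monicXnsubC // scale1r in def_r; apply: sigW.
(* Since n is non-zero in [K], the polynomial X^n - 1 is separable, so [r] lists n distinct n-th
   roots of unity. *)
have /hasP[z _ prim_z]: has n.-primitive_root r; last by exists z.
apply: has_prim_root => //; first by apply/allP=> z; rewrite -root_prod_XsubC -def_r.
  by rewrite -separable_prod_XsubC -def_r separable_Xn_sub_1.
by rewrite -ltnS -(size_prod_XsubC r id) -def_r size_XnsubC.
Qed.

(** The non-zero elements of [F] are #|F| - 1 distinct roots of unity of that order, so one of them
    is primitive; a suitable power has order [m]. *)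
Lemma finField_prim_root (F : finFieldType) m :
  (m %| #|F|.-1)%N -> {z : F | m.-primitive_root z}.
Proof.
move=> m_dv; have F_gt1 := finNzRing_gt1 F.
have n_gt0 : (0 < #|F|.-1)%N by rewrite -subn1 subn_gt0.
suffices /hasP/sig2W[z _ prim_z] : has (#|F|.-1).-primitive_root (enum (predC1 (0 : F))).
  by exists (z ^+ (#|F|.-1 %/ m)); apply: dvdn_prim_root.
apply: has_prim_root; rewrite ?enum_uniq // -?cardE ?cardC1 //.
apply/allP=> x; rewrite mem_enum inE unity_rootE => nz_x.
by rewrite -(inj_eq (mulfI nz_x)) -exprS prednK ?(ltnW F_gt1) // expf_card mulr1.
Qed.

Section MuCharacters.

Variables (F : finFieldType) (q : nat) (K : closedFieldType).
Hypotheses (cardF : #|F| = (q ^ 2)%N) (charK : [pchar K] =i pred0).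

Let pcharK0 n : (n%:R == 0 :> K) = (n == 0)%N.
Proof. exact: (pcharf0P K).1 charK n. Qed.

Let q_gt0 : (0 < q)%N.
Proof. by have := finNzRing_gt1 F; rewrite cardF; case: q. Qed.

Let zetaP : {z : F | q.+1.-primitive_root z}.
Proof.
(* q^2 - 1 = (q - 1)(q + 1). *)
apply: finField_prim_root; rewrite cardF -subn1 -[1%N](exp1n 2) subn_sqr addn1.
exact: dvdn_mull.
Qed.
Let zeta := sval zetaP.
Let prim_zeta : q.+1.-primitive_root zeta := svalP zetaP.

Let muX_subproof k : (zeta ^+ k) ^+ q.+1 == 1.
Proof. by rewrite exprAC (prim_expr_order prim_zeta) expr1n. Qed.
Let muX (k : nat) : mu F q := Mu (muX_subproof k).

(** Discrete logarithm to base [zeta]; with [muX] it identifies mu_(q+1) with the integers modulo q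
    + 1. *)
Let dlog (x : mu F q) : 'I_q.+1 := sval (prim_rootP prim_zeta (muP x)).

Let dlogK x : muX (dlog x) = x.
Proof. by apply: val_inj; rewrite /= -(svalP (prim_rootP prim_zeta (muP x))). Qed.

Let muXK (k : 'I_q.+1) : dlog (muX k) = k.
Proof.
apply: val_inj; have /(congr1 val)/eqP := dlogK (muX k).
by rewrite /= (eq_prim_root_expr prim_zeta) !modn_small // => /eqP.
Qed.

Lemma card_mu : #|{: mu F q}| = q.+1.
Proof.
have bij_dlog : bijective dlog by exists (fun k : 'I_q.+1 => muX k).
by rewrite (bij_eq_card bij_dlog) card_ord.
Qed.

Lemma mu_dual1 (chi : mu_dual F q K) : chi 1%g = 1.
Proof. by case/andP: (valP chi) => /eqP. Qed.

Lemma mu_dualM (chi : mu_dual F q K) x y : chi (x * y)%g = chi x * chi y.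
Proof. by case/andP: (valP chi) => _ /forallP/(_ x)/forallP/(_ y)/eqP. Qed.

(** For a primitive (q+1)-st root of unity w in [K], the characters are exactly x |-> w^(k dlog x)
    for k <= q, so the sum is geometric with ratio w^(dlog x). *)
Lemma sum_mu_dual (x : mu F q) :
  \sum_(chi : mu_dual F q K) chi x = if x == 1%g then q.+1%:R else 0.
Proof.
have nz_q1: q.+1%:R != 0 :> K by rewrite pcharK0.
have [w prim_w] := closed_field_prim_root nz_q1.
have muXM i j : (muX i * muX j)%g = muX (i + j).
  by apply: val_inj; rewrite /= exprD.
have chiX (chi : mu_dual F q K) k : chi (muX k) = chi (muX 1) ^+ k.
  elim: k => [|k IHk]; last by rewrite -add1n -muXM mu_dualM IHk exprS.
  by rewrite expr0 -(mu_dual1 chi); congr (chi _); apply: val_inj.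
have chi_subproof (k : 'I_q.+1) : is_char [ffun x : mu F q => w ^+ (k * dlog x)].
  have logM y z : dlog (y * z)%g = dlog y + dlog z %[mod q.+1].
    apply/eqP; rewrite -(eq_prim_root_expr prim_zeta); apply/eqP.
    have := congr1 val (dlogK (y * z)%g); rewrite /= => ->.
    by rewrite exprD -[in LHS](dlogK y) -[in LHS](dlogK z).
  have wM y z : w ^+ (k * dlog (y * z)%g) = w ^+ (k * dlog y) * w ^+ (k * dlog z).
    rewrite -exprD -mulnDr; apply/eqP; rewrite (eq_prim_root_expr prim_w).
    by rewrite -modnMmr logM modnMmr.
  apply/andP; split; last by apply/forallP=> y; apply/forallP=> z; rewrite !ffunE wM.
  have nz_w : w != 0 by rewrite (prim_root_eq0 prim_w).
  rewrite ffunE; apply/eqP/(mulfI (expf_neq0 (k * dlog 1%g) nz_w)).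
  by rewrite -wM mulg1 mulr1.
pose char_k k := MuDual (chi_subproof k).
have char_kE k y : char_k k y = w ^+ (k * dlog y) by rewrite /mu_dual_fun ffunE.
have chi1X (chi : mu_dual F q K) : chi (muX 1) ^+ q.+1 = 1.
  rewrite -chiX -(mu_dual1 chi); congr (chi _); apply: val_inj.
  exact: prim_expr_order.
(* A character is determined by its value at the generator [muX 1], which is a power of [w]. *)
pose k_char (chi : mu_dual F q K) := sval (prim_rootP prim_w (chi1X chi)).
have k_charE (chi : mu_dual F q K) : chi (muX 1) = w ^+ k_char chi.
  exact: svalP (prim_rootP prim_w (chi1X chi)).
have char_kK : cancel char_k k_char.
  have dlog1: dlog (muX 1) = 1%N :> nat.
    have lt1q : (1 < q.+1)%N by [].
    by rewrite (muXK (Ordinal lt1q)).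
  move=> k; apply: val_inj; have /eqP := k_charE (char_k k).
  by rewrite char_kE dlog1 muln1 (eq_prim_root_expr prim_w) !modn_small // => /eqP.
have k_charK : cancel k_char char_k.
  move=> chi; apply: val_inj; apply/ffunP=> y; rewrite ffunE exprM -k_charE -chiX.
  by rewrite dlogK.
rewrite (reindex char_k) /=; last by apply: onW_bij; exists k_char.
under eq_bigr do rewrite char_kE mulnC exprM.
have [x1 | nt_x] := eqVneq x 1%g.
  have dlog0: dlog x = ord0.
    by rewrite -(muXK ord0) x1; congr (dlog _); apply: val_inj.
  rewrite dlog0 expr0.
  by under eq_bigr do rewrite expr1n; rewrite sumr_const card_ord.
have nt_w: w ^+ dlog x != 1.
  apply: contraNneq nt_x => /eqP; rewrite -(expr0 w) (eq_prim_root_expr prim_w).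
  rewrite mod0n modn_small // => /eqP dlog0.
  by rewrite -(dlogK x) dlog0; apply/eqP/val_inj.
(* Multiplying by ratio - 1 telescopes the sum to ratio^(q+1) - 1 = 0. *)
apply: (mulfI (x := w ^+ dlog x - 1)); first by rewrite subr_eq0.
by rewrite mulr0 -subrX1 exprAC (prim_expr_order prim_w) expr1n subrr.
Qed.

End MuCharacters.

(** * Traces on isotypic parts *)

Lemma mxtrace_submod_proj (F : fieldType) (gT : finGroupType) (G : {group gT})
    n (rG : mx_representation F G n) (U P : 'M_n) (modU : mxmodule rG U) :
    (P <= U)%MS -> U *m P = U ->
  {in G, forall x, \tr (submod_repr modU x) = \tr (P *m rG x)}.
Proof.
move=> sPU UP x Gx.
have fixP m (W : 'M_(m, n)) : (W <= U)%MS -> W *m P = W.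
  by case/submxP=> V ->; rewrite -mulmxA UP.
(* [P] projects onto [U]: factor it through coordinates on [U] and rotate the trace, so that [P]
   follows [rG x] and fixes the rows of [U]. *)
rewrite -(in_submodK sPU) val_submodE -mulmxA [RHS]mxtrace_mulC (in_submodE _ P).
rewrite [in RHS]mulmxA fixP //; last first.
  by rewrite mxmodule_trans // val_submodP.
by rewrite -in_submodE.
Qed.

Lemma mxtrace_big_dadd_grepr (R : fieldType) (gT : finGroupType)
    (G : {group gT}) (I : Type) (r : seq I) (P : pred I)
    (rG : I -> representation R G) x :
  \tr ((\big[@dadd_grepr R _ _/@grepr0 R _ _]_(i <- r | P i) rG i) x)
    = \sum_(i <- r | P i) \tr (rG i x).
Proof.
elim: r => [|i r IHr]; first by rewrite !big_nil mxtrace1.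
by rewrite !big_cons; case: (P i); rewrite //= mxtrace_block IHr.
Qed.

Section IsotypicTrace.

Variables (F : finFieldType) (q : nat) (K : closedFieldType).
Hypotheses (cardF : #|F| = (q ^ 2)%N) (charK : [pchar K] =i pred0).

Variables (m d : nat) (omega : mx_representation K [set: Um F q m] d).

Let nz_q1 : q.+1%:R != 0 :> K.
Proof. by rewrite ((pcharf0P K).1 charK). Qed.

Lemma Um_scalM (x y : mu F q) : (Um_scal m (x * y) = Um_scal m x * Um_scal m y)%g.
Proof. by apply: val_inj; rewrite /= scalar_mxM. Qed.

(** The average of chi(z)^-1 omega(z) over mu_(q+1) is the projector onto the isotypic part. *)
Lemma mxtrace_isotypic_part (chi : mu_dual F q K) (g : Um F q m) :
  \tr (isotypic_part omega chi g) =
    q.+1%:R^-1 * \sum_(z : mu F q) chi z^-1%g * \tr (omega (Um_scal m z * g)%g).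
Proof.
pose P := q.+1%:R^-1 *: \sum_(z : mu F q) chi z^-1%g *: omega (Um_scal m z).
have sPU: (P <= isotypic_mx omega chi)%MS.
  apply/sub_bigcapmxP=> y _; apply/eigenspaceP.
  rewrite -scalemxAl scalerA mulrC -scalerA; congr (_ *: _).
  rewrite mulmx_suml scaler_sumr [RHS](reindex_inj (mulIg y)).
  apply: eq_bigr => z _; rewrite -scalemxAl -repr_mxM ?inE // -Um_scalM scalerA.
  by rewrite -mu_dualM invMg mulKVg.
have UP: isotypic_mx omega chi *m P = isotypic_mx omega chi.
  rewrite -scalemxAr mulmx_sumr.
  under eq_bigr => z _.
    rewrite -scalemxAr.
    have /eigenspaceP -> : (isotypic_mx omega chi
        <= eigenspace (omega (Um_scal m z)) (chi z))%MS by apply: bigcapmx_inf.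
    rewrite scalerA -mu_dualM mulVg mu_dual1 scale1r; over.
  by rewrite sumr_const (card_mu cardF) -scaler_nat scalerA mulVf // scale1r.
rewrite (mxtrace_submod_proj (isotypic_mxmodule omega chi) sPU UP) ?inE //.
rewrite -scalemxAl mxtraceZ mulmx_suml raddf_sum; congr (_ * _).
by apply: eq_bigr => z _; rewrite /= -scalemxAl mxtraceZ repr_mxM ?inE.
Qed.

(** After exchanging the sums, orthogonality leaves only the term z = 1. *)
Lemma sum_mxtrace_isotypic_part (g : Um F q m) :
  \sum_(chi : mu_dual F q K) \tr (isotypic_part omega chi g) = \tr (omega g).
Proof.
under eq_bigr do rewrite mxtrace_isotypic_part.
rewrite -mulr_sumr exchange_big /= (bigD1 1%g) //= [X in _ + X]big1 => [|z nt_z].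
  rewrite -mulr_suml invg1 (sum_mu_dual cardF charK) eqxx addr0 mulKf //.
  by congr (\tr (omega _)); apply: val_inj; rewrite /= mul1mx.
by rewrite -mulr_suml (sum_mu_dual cardF charK) invg_eq1 (negPf nt_z) mul0r.
Qed.

End IsotypicTrace.

(** * Fixed spaces under the embedding, and the comparison of traces *)

Lemma rank_coker_scal_emb (F : finFieldType) (q n : nat) (z : mu F q) (g : Um F q n) :
  \rank (cokermx (Um_val (Um_scal (n + 1) z * Um_emb g)%g - 1%:M)) =
  (\rank (cokermx (Um_val (Um_scal n z * g)%g - 1%:M)) + (z == 1%g))%N.
Proof.
set A := Um_val (Um_scal n z * g)%g - 1%:M.
have ->: Um_val (Um_scal (n + 1) z * Um_emb g)%g - 1%:M
          = block_mx A 0 0 (mu_val z - 1)%:M.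
  rewrite /A /= (scalar_mx_block n 1 (mu_val z)) mulmx_block.
  rewrite !mulmx0 !mul0mx !addr0 !add0r mulmx1 [in RHS]raddfB /=.
  rewrite (scalar_mx_block n 1 1) opp_block_mx add_block_mx.
  by rewrite !oppr0 !addr0.
have z1: (mu_val z - 1 == 0) = (z == 1%g) by rewrite subr_eq0 -val_eqE.
rewrite !mxrank_coker rank_diag_block_mx.
(* This bound lets the truncated subtraction n + 1 - rank A split as (n - rank A) + 1. *)
have rA : (\rank A <= n)%N := rank_leq_row A.
have [z1e | nt_z] := eqVneq z 1%g.
  have ->: mu_val z - 1 = 0 by apply/eqP; rewrite z1 z1e.
  by rewrite raddf0 mxrank0 addn0 addnBAC.
rewrite [\rank _%:M]mxrank_unit /= ?subnDr ?addn0 //.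
by rewrite unitmxE det_scalar unitfE expf_neq0 // z1.
Qed.

Theorem proposition6p5
    (p f q : nat) (p_prime : prime p) (f_gt0 : (0 < f)%N) (q_def : q = (p ^ f)%N)
    (F : finFieldType) (cardF : #|F| = (q ^ 2)%N)
    (K : closedFieldType) (charK : [pchar K] =i pred0)
    (n : nat) (n_gt0 : (1 <= n)%N)
    (psi psi' : F -> K)
    (psi_char : nontrivial_add_char q psi)
    (psi'_char : nontrivial_add_char q psi')
    (d d' : nat)
    (rho : mx_representation K [set: HU cardF n] d)
    (rho_HW : is_Heisenberg_Weil rho psi)
    (rho' : mx_representation K [set: HU cardF (n + 1)] d')
    (rho'_HW : is_Heisenberg_Weil rho' psi')
    (chi : mu_dual F q K) :
  mx_rsim
    (pullback_repr (Um_emb_morphism F q n) (isotypic_part (res_Um rho') chi))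
    (\big[@dadd_grepr K _ _/@grepr0 K _ _]_(chi' : mu_dual F q K | chi' != chi)
       isotypic_part (res_Um rho) chi').
Proof.
have nz_q1 : q.+1%:R != 0 :> K by rewrite ((pcharf0P K).1 charK).
have tr_emb z g : \tr (res_Um rho' (Um_scal (n + 1) z * Um_emb g)%g) =
    (if z == 1%g then q.+1%:R else 0) * \tr (res_Um rho g)
      - \tr (res_Um rho (Um_scal n z * g)%g).
  rewrite (HW_trace rho'_HW) !(HW_trace rho_HW) rank_coker_scal_emb.
  rewrite !exprD expr1; case: eqP => [-> | _]; last first.
    by rewrite expr0 mulr1 mulrN1 mulNr mul0r add0r.
  have ->: (Um_scal n 1 * g = g)%g by apply: val_inj; rewrite /= mul1mx.
  (* For z = 1 the extra sign and the extra factor -q combine to q = (q + 1) - 1. *)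
  rewrite expr1 mulrN1 mulNr mulrN mulrN opprK -natr1 mulrDl mul1r addrK.
  by rewrite mulrA mulrC.
apply: (@mx_rsim_mxtrace _ _ [set: Um F q n]%G charK) => g _.
rewrite mxtrace_big_dadd_grepr.
have := sum_mxtrace_isotypic_part cardF charK (res_Um rho) g.
(* The right-hand trace is the full Weil trace minus its [chi] part. *)
rewrite (bigD1 chi) //= => /(canRL (addKr _)) ->.
rewrite !(mxtrace_isotypic_part cardF charK).
under eq_bigr do rewrite tr_emb mulrBr.
rewrite sumrB mulrBr addrC; congr (_ + _).
(* Only z = 1 survives in the remaining average, and its factor q + 1 cancels the normalisation. *)
rewrite (bigD1 1%g) //= [X in _ + X]big1 => [|z /negPf ->]; last by rewrite mul0r mulr0.
by rewrite eqxx invg1 mu_dual1 mul1r addr0 mulKf.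
Qed.
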